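(* Let $G$ be a group, let $A$ be a $G$-graded ring, let $E$ be a $G$-graded $A$-module, and let $R:=A\propto E$ be the trivial ring extension of $A$ by $E$. Then $A$ is graded nil-good if and only if $R$ is graded nil-good.
   Context: All rings are assumed to be associative with identity; they are not assumed commutative. A ring $A$ is $G$-graded if $A=\bigoplus_{g\in G}A_g$, where the $A_g$ are additive subgroups of $A$ and $A_gA_h\subseteq A_{gh}$ for all $g,h\in G$; the elements of $\bigcup_{g\in G}A_g$ are called homogeneous. A $G$-graded $A$-module is an $A$-module $E$ such that $E=\bigoplus_{g\in G}E_g$, where the $E_g$ are additive subgroups of $E$ and $A_hE_g\subseteq E_{hg}$ for all $g,h\in G$. The trivial ring extension $A\propto E$ of $A$ by $E$ is the set of pairs $(a,x)$ with $a\in A$, $x\in E$, with pairwise addition and multiplication given by $(a,x)(b,y)=(ab,ay+bx)$. This construction, usual for commutative $A$, is used in the same form for noncommutative $A$. When $A$ is a $G$-graded ring and $E$ is a $G$-graded $A$-module, $R=A\propto E$ is regarded as $G$-graded with components $R_g=A_g\oplus E_g$ ($g\in G$). A homogeneous element of a $G$-graded ring is graded nil-good if it is either nilpotent or can be written as a sum of a homogeneous unit and a homogeneous nilpotent. A $G$-graded ring is graded nil-good if each of its homogeneous elements is graded nil-good. *)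

(* Defs.v *)
From mathcomp Require Import all_boot all_algebra classical_sets.

Set Implicit Arguments.
Unset Strict Implicit.
Unset Printing Implicit Defensive.

Import GRing.Theory.
Local Open Scope ring_scope.

Definition additive_subgroup (V : zmodType) (S : set V) : Prop :=
  S 0 /\ forall x y, S x -> S y -> S (x - y).

(* V is the internal direct sum of the V_ g.  G may be infinite, so the sums   *)
(* run over finite lists of indices.                                          *)
Record direct_sum (G : groupType) (V : zmodType) (V_ : G -> set V) : Prop :=
  DirectSum {
    direct_sum_subgroup : forall g, additive_subgroup (V_ g);
    direct_sum_span : forall x, exists (s : seq G) (f : G -> V),
      (forall g, V_ g (f g)) /\ x = \sum_(g <- s) f g;
    direct_sum_indep : forall (s : seq G) (f : G -> V), uniq s ->
      (forall g, V_ g (f g)) -> \sum_(g <- s) f g = 0 ->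
      forall g, g \in s -> f g = 0
  }.

Definition graded_ring (G : groupType) (A : pzRingType) (A_ : G -> set A) :
    Prop :=
  direct_sum A_ /\
  forall g h a b, A_ g a -> A_ h b -> A_ (g * h)%g (a * b).

Definition graded_module (G : groupType) (A : pzRingType) (A_ : G -> set A)
    (E : lmodType A) (E_ : G -> set E) : Prop :=
  direct_sum E_ /\
  forall h g a x, A_ h a -> E_ g x -> E_ (h * g)%g (a *: x).

(* The multiplication of a trivial ring extension is associative only when    *)
(* the commutators of A annihilate E (triv_mulA_iff below), so in general it  *)
(* is not a pzRingType.  The notions used for both A and its extension are    *)
(* therefore stated for an additive group V with a unit element and a         *)
(* multiplication; on a ring they are the usual ones.                         *)
Section GradedNilGood.
Variables (G : groupType) (V : zmodType) (one : V) (mul : V -> V -> V).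
Variable V_ : G -> set V.

Definition homogeneous (x : V) : Prop := exists g, V_ g x.

Definition is_unit (x : V) : Prop := exists y, mul x y = one /\ mul y x = one.

(* iterop n mul x one = mul x (mul x (... x)), with n factors: this is how    *)
(* x ^+ n is defined in a ring (nilpotent_ringE below).                       *)
Definition nilpotent (x : V) : Prop :=
  exists n : nat, (0 < n)%N /\ iterop n mul x one = 0.

Definition graded_nil_good_elt (x : V) : Prop :=
  nilpotent x \/
  exists u n, [/\ homogeneous u, is_unit u, homogeneous n, nilpotent n &
                  x = u + n].

Definition graded_nil_good : Prop :=
  forall x, homogeneous x -> graded_nil_good_elt x.

End GradedNilGood.

Section TrivialExtension.
Variables (A : pzRingType) (E : lmodType A).

(* The product zmodType, hence with pairwise addition. *)
Definition triv_ext : zmodType := (A * E)%type.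

Definition triv_one : triv_ext := (1, 0).

Definition triv_mul (p q : triv_ext) : triv_ext :=
  (p.1 * q.1, p.1 *: q.2 + q.1 *: p.2).

Definition triv_comp (G : groupType) (A_ : G -> set A) (E_ : G -> set E) :
    G -> set triv_ext :=
  fun g => [set p : triv_ext | A_ g p.1 /\ E_ g p.2]%classic.

End TrivialExtension.
Arguments triv_one {A E}.
Arguments triv_mul {A E}.

Lemma nilpotent_ringE (A : pzRingType) (a : A) :
  nilpotent 1 *%R a = exists n : nat, (0 < n)%N /\ a ^+ n = 0.
Proof. by []. Qed.

Lemma triv_mul1 (A : pzRingType) (E : lmodType A) :
  left_id triv_one (@triv_mul A E) /\ right_id triv_one (@triv_mul A E).
Proof.
by split=> -[a x]; rewrite /triv_mul /= ?mul1r ?mulr1 scale1r scaler0 ?addr0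
   ?add0r.
Qed.

Lemma triv_mulDl (A : pzRingType) (E : lmodType A) :
  left_distributive (@triv_mul A E) +%R.
Proof.
by move=> [a x] [b y] [c z]; congr pair; rewrite /= ?mulrDl // scalerDl scalerDr
   addrACA.
Qed.

Lemma triv_mulDr (A : pzRingType) (E : lmodType A) :
  right_distributive (@triv_mul A E) +%R.
Proof.
by move=> [a x] [b y] [c z]; congr pair; rewrite /= ?mulrDr // scalerDl scalerDr
   addrACA.
Qed.

Lemma triv_mulA_iff (A : pzRingType) (E : lmodType A) :
  associative (@triv_mul A E) <->
  forall (a b : A) (x : E), (a * b) *: x = (b * a) *: x.
Proof.
split=> [mulA a b x | comm [a x] [b y] [c z]].
  have := congr1 snd (mulA (a, 0) (1, x) (b, 0)).
  by rewrite /= !(scaler0, add0r, addr0, mulr1, scalerA).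
congr pair; rewrite /= ?mulrA // !scalerDr !scalerA addrA (comm a c).
by rewrite (comm b c).
Qed.

(* Main.v *)
Require Import Defs.
From mathcomp Require Import all_boot all_algebra classical_sets.
Local Open Scope ring_scope.

(** Both halves of graded nil-goodness pass between [A] and the extension
    through the first projection: a pair is nilpotent, or invertible, exactly
    when its first component is ([nilpotent_trivE], [is_unit_trivE]).  The
    product of the extension need not be associative, but both facts come down
    to the action on [E] of a single element of [A] and of its powers or its
    inverse, which commute with it.

    Projecting a decomposition in the extension therefore gives one in [A].
    Conversely a decomposition [a = u + n] in [A] should be lifted to
    [(a, x) = (u, x) + (n, 0)], and the one obstacle is that [(u, x)] has to be
    homogeneous: [u] must have the degree of [a].  By uniqueness of homogeneous
    components, [u] can only have another degree if it is zero or is cancelled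
    by [n] ([homogeneous_summand]).  In both cases the unit [u] is nilpotent,
    so [A] is trivial, and then every pair is nilpotent. *)

Set Implicit Arguments.
Unset Strict Implicit.
Unset Printing Implicit Defensive.

Import GRing.Theory.

Section PairsAndFirstComponents.
Variables (A : pzRingType) (E : lmodType A).

(** Each step multiplies the second component by [a] and adds one more copy of
    the current power of [a] times [x], hence the shape of the derivative of a
    power. *)
Lemma iterop_triv_mul (a : A) (x : E) m :
  iterop m.+1 triv_mul ((a, x) : triv_ext E) triv_one =
  (a ^+ m.+1, (a ^+ m *: x) *+ m.+1).
Proof.
rewrite iteropS; elim: m => [|m IHm]; first by rewrite expr0 scale1r.
rewrite iterS IHm /triv_mul /= -exprS; congr pair.
by rewrite -scalerMnr scalerA -exprS -mulrSr.
Qed.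

(** If [a ^+ m = 0] then one more factor also kills the second component. *)
Lemma nilpotent_trivE (p : triv_ext E) :
  nilpotent triv_one triv_mul p <-> nilpotent 1 *%R p.1.
Proof.
case: p => a x; rewrite nilpotent_ringE /=; split=> -[[|m] [//= _ pm0]].
  by exists m.+1; split=> //; move: pm0; rewrite [LHS]iterop_triv_mul => -[].
exists m.+2; split=> //.
by rewrite [LHS]iterop_triv_mul exprS pm0 mulr0 scale0r mul0rn.
Qed.

Lemma is_unit_trivE (p : triv_ext E) :
  is_unit triv_one triv_mul p <-> is_unit 1 *%R p.1.
Proof.
case: p => a x; split=> [[[b y] [[ab1 _] [ba1 _]]] | [b /= [ab1 ba1]]].
  by exists b.
(* With second factor (b, y), both products have second component
   a *: y + b *: x, and its vanishing determines y. *)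
exists (b, - (b *: (b *: x))).
rewrite /triv_mul /triv_one /= ab1 ba1 scalerN !scalerA ab1 mul1r.
by rewrite addNr subrr.
Qed.

End PairsAndFirstComponents.

Section RingNilpotents.
Variable A : pzRingType.

Lemma nilpotent0 : nilpotent 1 *%R (0 : A).
Proof. by exists 1%N. Qed.

Lemma nilpotentN (a : A) : nilpotent 1 *%R a -> nilpotent 1 *%R (- a).
Proof.
rewrite !nilpotent_ringE => -[m [m_gt0 am0]].
by exists m; split; rewrite // exprNn am0 mulr0.
Qed.

Lemma nilpotent_unit_trivial (u : A) :
  is_unit 1 *%R u -> nilpotent 1 *%R u -> 1 = 0 :> A.
Proof.
rewrite nilpotent_ringE => -[v [uv1 vu1]] [m [_ um0]].
have comm_uv : GRing.comm u v by rewrite /GRing.comm uv1 vu1.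
by rewrite -(expr1n A m) -uv1 exprMn_comm // um0 mul0r.
Qed.

End RingNilpotents.

Section DirectSums.
Variables (G : groupType) (V : zmodType) (V_ : G -> set V).
Hypothesis dirV : direct_sum V_.

Let zeroV g : V_ g 0. Proof. by case: (direct_sum_subgroup dirV g). Qed.

Let subV g x y : V_ g x -> V_ g y -> V_ g (x - y).
Proof. by case: (direct_sum_subgroup dirV g) => _; apply. Qed.

(** Collect [a - b - c = 0] by degree: as [a] does not contribute in degree
    [h], that component is [- b] or, when [c] also has degree [h],
    [- b - c]. *)
Lemma homogeneous_summand g h k a b c :
  V_ g a -> V_ h b -> V_ k c -> a = b + c -> h != g -> b = 0 \/ b = - c.
Proof.
move=> Va Vb Vc abc neq_hg.
pose single (j : G) (z : V) (i : G) : V := if i == j then z else 0.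
have single_in j z i : V_ j z -> V_ i (single j z i).
  by rewrite /single; case: eqP => [->|].
pose s := undup [:: g; h; k].
have sum_single j z : j \in s -> \sum_(i <- s) single j z i = z.
  move=> sj; rewrite (bigD1_seq j) ?undup_uniq // {1}/single eqxx.
  by rewrite big1 ?[LHS]addr0 // /single => i /negPf ->.
have : single g a h - single h b h - single k c h = 0.
  apply: (direct_sum_indep dirV (s := s)
    (f := fun i => single g a i - single h b i - single k c i)).
  - exact: undup_uniq.
  - by move=> i; apply: subV; [apply: subV|]; apply: single_in.
  - rewrite !sumrB !sum_single ?mem_undup ?inE ?eqxx ?orbT //.
    by rewrite -addrA -opprD abc subrr.
  - by rewrite mem_undup !inE eqxx orbT.
rewrite /single (negPf neq_hg) eqxx sub0r; case: eqP => _ /eqP.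
  by rewrite subr_eq0 => /eqP <-; right; rewrite opprK.
by rewrite subr0 oppr_eq0 => /eqP; left.
Qed.

End DirectSums.

Theorem theorem4p1 (G : groupType) (A : pzRingType) (E : lmodType A)
    (A_ : G -> set A) (E_ : G -> set E) :
  graded_ring A_ -> graded_module A_ E_ ->
  graded_nil_good 1 *%R A_ <->
  graded_nil_good triv_one triv_mul (triv_comp A_ E_).
Proof.
move=> [dirA _] [dirE _].
have E0 g : E_ g 0 by case: (direct_sum_subgroup dirE g).
split=> [nilgoodA [a x] [g [/= Aa Ex]] | nilgoodR a [g Aa]]; last first.
  have /nilgoodR : homogeneous (triv_comp A_ E_) (a, 0) by exists g.
  case=> [/nilpotent_trivE|[u [n [[h [Au _]] unit_u [k [An _]] nil_n eq_a]]]].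
    by left.
  right; exists u.1, n.1; split; [by exists h | exact/is_unit_trivE
    | by exists k | exact/nilpotent_trivE |].
  exact: (congr1 (fun p : triv_ext E => p.1) eq_a).
have [|nil_a|[u [n [[h Au] unit_u [k An] nil_n eq_a]]]] := nilgoodA a.
- by exists g.
- by left; apply/nilpotent_trivE.
have [eq_hg|neq_hg] := eqVneq h g; last first.
  have nil_u : nilpotent 1 *%R u.
    have [->|->] := homogeneous_summand dirA Aa Au An eq_a neq_hg.
      exact: nilpotent0.
    exact: nilpotentN.
  left; apply/nilpotent_trivE.
  have -> : a = 0.
    by rewrite -[a]mul1r (nilpotent_unit_trivial unit_u nil_u) mul0r.
  exact: nilpotent0.
rewrite eq_hg in Au; right; exists (u, x), (n, 0); split.
- by exists g.
- exact/is_unit_trivE.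
- by exists k.
- exact/nilpotent_trivE.
- by rewrite eq_a; congr pair; rewrite /= addr0.
Qed.
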